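(* Let $A,B\in\bigwedge^p X$ be $p$-blades ($p\ge1$) in a Euclidean space $X$, and let $\Phi=\Phi_{A,B}$ be the oriented angle bivector from $[A]$ to $[B]$ (formed with given associated principal bases of $[A]$ and $[B]$). If $\|A\|=\|B\|=1$ then $$B = e^{-\frac{\Phi}{2}}\, A\, e^{\frac{\Phi}{2}} = A\, e^{\Phi} = e^{-\Phi} A .$$
   Context: $X$ is an $n$-dimensional Euclidean space. $\bigwedge X$ is its exterior algebra, equipped with the Clifford geometric product (written by juxtaposition), for which $vw=v\cdot w+v\wedge w$ for $v,w\in X$. $\bigwedge X$ carries the usual inner product and norm $\|\cdot\|$ induced from $X$. For $M\in\bigwedge X$, $e^M=\sum_{k\ge0}M^k/k!$. A $p$-blade ($p\ge1$) is $A=v_1\wedge\cdots\wedge v_p$ with $v_i\in X$; if $A\ne0$, $[A]=\mathrm{span}(v_1,\ldots,v_p)$. Let $V=[A]$, $W=[B]$. Their principal angles $0\le\theta_1\le\cdots\le\theta_p\le\frac\pi2$ and associated principal bases (orthonormal bases) $(e_1,\ldots,e_p)$ of $V$ and $(f_1,\ldots,f_p)$ of $W$ are characterized by $e_i\cdot f_j=\delta_{ij}\cos\theta_i$ for all $i,j$. Let $d=\dim(V\cap W)$. The principal bivectors are $I_i=0$ for $i\le d$ and $I_i=\frac{e_i\wedge f_i}{\|e_i\wedge f_i\|}$ for $i>d$. The angle bivector is $\Phi_{V,W}=\sum_{i=1}^p\theta_iI_i$. Write $A=\epsilon_A\|A\|e_1\cdots e_p$ and $B=\epsilon_B\|B\|f_1\cdots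 f_p$ with $\epsilon_A,\epsilon_B\in\{1,-1\}$; the relative orientation (with respect to these bases) is $\epsilon_{A,B}=\epsilon_A\epsilon_B$. The oriented angle bivector is $\Phi_{A,B}=\Phi_{V,W}$ if $\epsilon_{A,B}=1$, and $\Phi_{A,B}=\Phi_{V,W}-\pi I_p$ if $\epsilon_{A,B}=-1$.
   Formalization: The case B = -A is excluded: there [A] = [B], so all principal bivectors (including I_p) are 0, Φ_{A,B} = 0, and the claim would read -A = A, which is false for a unit blade; the formal statement assumes B ≠ -A. *)

(* Defs.v *)
From HB Require Import structures.
From mathcomp Require Import all_boot all_order all_algebra.

Set Implicit Arguments.
Unset Strict Implicit.
Unset Printing Implicit Defensive.

Import Order.TTheory GRing.Theory Num.Theory.

Local Open Scope ring_scope.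

(* A Euclidean space of dimension n is represented by R^n ('rV[R]_n) with the
   dot product, and its exterior algebra by the coordinates M S of a
   multivector M on the basis e_S = e_{i_1} /\ ... /\ e_{i_k}, where
   S = {i_1 < ... < i_k} ranges over the subsets of 'I_n.  Multiplication in
   the ring [mvec R n] is the geometric (Clifford) product. *)

Section Multivectors.
Context {R : comNzRingType} {n : nat}.
Implicit Types S T U : {set 'I_n}.

Definition symdiff S T : {set 'I_n} := (S :\: T) :|: (T :\: S).

(* The parity of the number of inversions (i, j), j < i, that sort the
   concatenation of S and T. *)
Definition reorder_sign S T : R :=
  \prod_(i in S) \prod_(j in T | (j < i)%N) (-1).

Definition wedge_sign S T : R := [disjoint S & T]%:R * reorder_sign S T.

Definition mvec : Type := {ffun {set 'I_n} -> R^o}.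

HB.instance Definition _ := GRing.Lmodule.on mvec.

Implicit Types M N P : mvec.

(* The bilinear product with e_S e_T = c S T e_(symdiff S T). *)
Definition twisted_mul (c : {set 'I_n} -> {set 'I_n} -> R) M N : mvec :=
  [ffun U => \sum_S \sum_(T | symdiff S T == U) c S T * (M S * N T)].

Definition geom_mul : mvec -> mvec -> mvec := twisted_mul reorder_sign.

(* [symdiff S T = S :|: T] whenever the coefficient [wedge_sign S T] is
   nonzero. *)
Definition wedge : mvec -> mvec -> mvec := twisted_mul wedge_sign.

Definition basis_blade S : mvec := [ffun T => (T == S)%:R].

Lemma in_symdiff S T i : (i \in symdiff S T) = (i \in S) (+) (i \in T).
Proof. by rewrite !inE; case: (i \in S); case: (i \in T). Qed.

Lemma symdiffA : associative symdiff.
Proof. by move=> S T U; apply/setP=> i; rewrite !in_symdiff addbA. Qed.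

Lemma symdiff0s : left_id set0 symdiff.
Proof. by move=> S; apply/setP=> i; rewrite in_symdiff inE. Qed.

Lemma symdiffs0 : right_id set0 symdiff.
Proof. by move=> S; apply/setP=> i; rewrite in_symdiff inE addbF. Qed.

Lemma symdiffss S : symdiff S S = set0.
Proof. by apply/setP=> i; rewrite in_symdiff inE addbb. Qed.

Lemma symdiffKs S : involutive (symdiff S).
Proof. by move=> T; rewrite symdiffA symdiffss symdiff0s. Qed.

Lemma twisted_mulE c M N U :
  twisted_mul c M N U =
  \sum_S c S (symdiff S U) * (M S * N (symdiff S U)).
Proof.
rewrite ffunE; apply: eq_bigr => S _.
rewrite (big_pred1 (symdiff S U)) // => T /=.
by apply/eqP/eqP => [<-|->]; rewrite symdiffKs.
Qed.

Lemma mvecDE M N S : (M + N) S = M S + N S.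
Proof. by rewrite ffunE. Qed.

Lemma mvecZE a M S : (a *: M) S = a * M S.
Proof. by rewrite ffunE. Qed.

Lemma twisted_mulDl c : left_distributive (twisted_mul c) +%R.
Proof.
move=> M N P; apply/ffunP=> U; rewrite mvecDE !twisted_mulE -big_split /=.
by apply: eq_bigr => S _; rewrite mvecDE mulrDl mulrDr.
Qed.

Lemma twisted_mulDr c : right_distributive (twisted_mul c) +%R.
Proof.
move=> M N P; apply/ffunP=> U; rewrite mvecDE !twisted_mulE -big_split /=.
by apply: eq_bigr => S _; rewrite mvecDE !mulrDr.
Qed.

Lemma twisted_mulZl c a M N :
  a *: twisted_mul c M N = twisted_mul c (a *: M) N.
Proof.
apply/ffunP=> U; rewrite mvecZE !twisted_mulE mulr_sumr.
by apply: eq_bigr => S _; rewrite mvecZE -!mulrA mulrCA.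
Qed.

Lemma twisted_mulZr c a M N :
  a *: twisted_mul c M N = twisted_mul c M (a *: N).
Proof.
apply/ffunP=> U; rewrite mvecZE !twisted_mulE mulr_sumr.
by apply: eq_bigr => S _; rewrite mvecZE mulrCA; congr (_ * _); rewrite mulrCA.
Qed.

Lemma twisted_mulA c :
  (forall S T U, c S (symdiff T U) * c T U = c S T * c (symdiff S T) U) ->
  associative (twisted_mul c).
Proof.
move=> cA M N P; apply/ffunP=> U; rewrite !twisted_mulE.
transitivity (\sum_S \sum_T c S (symdiff S U) * (M S * (
    c T (symdiff T (symdiff S U)) * (N T * P (symdiff T (symdiff S U)))))).
  by apply: eq_bigr => S _; rewrite twisted_mulE !mulr_sumr.
transitivity (\sum_T \sum_S c T (symdiff T U) * (c S (symdiff S T) *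
    (M S * N (symdiff S T)) * P (symdiff T U))); last first.
  by apply: eq_bigr => S _; rewrite twisted_mulE mulr_suml mulr_sumr.
rewrite [RHS]exchange_big /=; apply: eq_bigr => S _.
rewrite [RHS](reindex_inj (inv_inj (symdiffKs S))) /=.
apply: eq_bigr => T _; rewrite symdiffKs !symdiffA.
have -> : symdiff (symdiff T S) U = symdiff (symdiff S T) U.
  by congr symdiff; apply/setP => i; rewrite !in_symdiff addbC.
set V := symdiff (symdiff S T) U.
have -> : symdiff S U = symdiff T V.
  apply/setP => i; rewrite !in_symdiff.
  by case: (i \in S); case: (i \in T); case: (i \in U).
set x := M S; set y := N T; set z := P V.
transitivity ((c S (symdiff T V) * c T V) * (x * (y * z))).
  by rewrite -!mulrA; congr (_ * _); rewrite mulrCA.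
by rewrite cA -!mulrA mulrCA.
Qed.

Lemma prod_symdiff (f : 'I_n -> R) S T : (forall i, f i * f i = 1) ->
  \prod_(i in symdiff S T) f i = \prod_(i in S) f i * \prod_(i in T) f i.
Proof.
move=> ff; rewrite big_mkcond [X in X * _]big_mkcond [X in _ * X]big_mkcond.
rewrite -big_split; apply: eq_bigr => i _; rewrite in_symdiff.
by case: (i \in S); case: (i \in T); rewrite /= ?mulr1 ?mul1r ?ff.
Qed.

Lemma reorder_signE S T :
  reorder_sign S T = \prod_(i in S) \prod_(j in T) (-1) ^+ (j < i)%N.
Proof.
apply: eq_bigr => i _; rewrite big_mkcondr; apply: eq_bigr => j _.
by case: ifP.
Qed.

Lemma reorder_signDl S T U :
  reorder_sign (symdiff S T) U = reorder_sign S U * reorder_sign T U.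
Proof.
rewrite !reorder_signE prod_symdiff // => i; rewrite -big_split big1 //= => j _.
by rewrite -signr_addb addbb.
Qed.

Lemma reorder_signDr S T U :
  reorder_sign S (symdiff T U) = reorder_sign S T * reorder_sign S U.
Proof.
rewrite !reorder_signE -big_split; apply: eq_bigr => i _.
by rewrite /= prod_symdiff // => j; rewrite -signr_addb addbb.
Qed.

Lemma reorder_sign0s T : reorder_sign set0 T = 1.
Proof. by rewrite /reorder_sign big_set0. Qed.

Lemma reorder_signs0 S : reorder_sign S set0 = 1.
Proof. by rewrite reorder_signE big1 // => i _; rewrite big_set0. Qed.

Lemma geom_mulA : associative geom_mul.
Proof.
apply: twisted_mulA => S T U.
by rewrite reorder_signDl reorder_signDr mulrA.
Qed.

Lemma twisted_mul_basisl c S N U :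
  twisted_mul c (basis_blade S) N U = c S (symdiff S U) * N (symdiff S U).
Proof.
rewrite twisted_mulE (bigD1 S) //= ffunE eqxx mul1r big1 ?addr0 // => T neqTS.
by rewrite ffunE (negPf neqTS) mul0r mulr0.
Qed.

Lemma twisted_mul_basis c S T :
  twisted_mul c (basis_blade S) (basis_blade T) =
  c S T *: basis_blade (symdiff S T).
Proof.
apply/ffunP=> U; rewrite twisted_mul_basisl !ffunE.
have -> : (symdiff S U == T) = (U == symdiff S T).
  by apply/eqP/eqP => [<-|->]; rewrite symdiffKs.
by case: eqP => [->|_]; [rewrite symdiffKs | rewrite scaler0 mulr0].
Qed.

Lemma geom_mul1m : left_id (basis_blade set0) geom_mul.
Proof.
move=> M; apply/ffunP=> U.
by rewrite twisted_mul_basisl symdiff0s reorder_sign0s mul1r.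
Qed.

Lemma geom_mulm1 : right_id (basis_blade set0) geom_mul.
Proof.
move=> M; apply/ffunP=> U; rewrite twisted_mulE (bigD1 U) //= symdiffss.
rewrite reorder_signs0 mul1r ffunE eqxx mulr1 big1 ?addr0 // => S neqSU.
rewrite [basis_blade _ _]ffunE; case: eqP => [eqSU|_]; last by rewrite !mulr0.
by case/eqP: neqSU; rewrite -[U](symdiffKs S) eqSU symdiffs0.
Qed.

Lemma basis_blade0_neq0 : basis_blade set0 != 0.
Proof.
apply/eqP => /ffunP/(_ set0)/eqP.
by rewrite !ffunE eqxx oner_eq0.
Qed.

HB.instance Definition _ := GRing.Zmodule_isNzRing.Build mvec
  geom_mulA geom_mul1m geom_mulm1
  (@twisted_mulDl reorder_sign) (@twisted_mulDr reorder_sign) basis_blade0_neq0.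

HB.instance Definition _ := GRing.Lmodule_isLalgebra.Build R mvec
  (@twisted_mulZl reorder_sign).

HB.instance Definition _ := GRing.Lalgebra_isAlgebra.Build R mvec
  (@twisted_mulZr reorder_sign).

Lemma wedgeA : associative wedge.
Proof.
apply: twisted_mulA => S T U; rewrite /wedge_sign.
have disj : [disjoint S & symdiff T U]%:R * [disjoint T & U]%:R =
            [disjoint S & T]%:R * [disjoint symdiff S T & U]%:R :> R.
  rewrite -!natrM !mulnb; congr (nat_of_bool _)%:R.
  apply/andP/andP => -[]; rewrite -!setI_eq0 => /eqP/setP h1 /eqP/setP h2;
    split; apply/eqP/setP => i; move: (h1 i) (h2 i); rewrite !inE;
    by case: (i \in S); case: (i \in T); case: (i \in U).
rewrite mulrACA disj reorder_signDr mulrACA reorder_signDl.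
by rewrite !mulrA; congr (_ * _); rewrite mulrAC.
Qed.

Definition dotv (v w : 'rV[R]_n) : R := \sum_i v 0 i * w 0 i.

Definition vec (v : 'rV[R]_n) : mvec := \sum_i v 0 i *: basis_blade [set i].

Lemma twisted_mul_vec c (v w : 'rV[R]_n) :
  twisted_mul c (vec v) (vec w) =
  \sum_i \sum_j (v 0 i * w 0 j) *: (c [set i] [set j] *:
    basis_blade (symdiff [set i] [set j])).
Proof.
have t0m M : twisted_mul c 0 M = 0.
  by rewrite -[X in twisted_mul _ X]((scale0r (0 : mvec))) -twisted_mulZl scale0r.
have tm0 M : twisted_mul c M 0 = 0.
  by rewrite -[X in twisted_mul _ _ X]((scale0r (0 : mvec))) -twisted_mulZr scale0r.
rewrite /vec (big_morph (fun M => twisted_mul c M _)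
  (fun M N => twisted_mulDl c M N _) (t0m _)).
apply: eq_bigr => i _.
rewrite (big_morph (twisted_mul c _) (twisted_mulDr c _) (tm0 _)).
apply: eq_bigr => j _.
by rewrite -twisted_mulZl -twisted_mulZr twisted_mul_basis [LHS]scalerA.
Qed.

Lemma reorder_sign1 (i j : 'I_n) :
  reorder_sign [set i] [set j] = (-1) ^+ (j < i)%N.
Proof. by rewrite reorder_signE !big_set1. Qed.

Lemma wedge_sign1 (i j : 'I_n) :
  wedge_sign [set i] [set j] = (i != j)%:R * (-1) ^+ (j < i)%N.
Proof. by rewrite /wedge_sign reorder_sign1 disjoints1 inE. Qed.

Lemma vecM (v w : 'rV[R]_n) :
  vec v * vec w = (dotv v w)%:A + wedge (vec v) (vec w).
Proof.
rewrite [LHS]twisted_mul_vec /wedge twisted_mul_vec /dotv scaler_suml -big_split.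
apply: eq_bigr => i _ /=; rewrite (bigD1 i) //= [in RHS](bigD1 i) //=.
rewrite reorder_sign1 wedge_sign1 ltnn eqxx !mul0r scale0r scaler0 add0r.
rewrite scale1r symdiffss; congr (_ + _); apply: eq_bigr => j neqji.
by rewrite reorder_sign1 wedge_sign1 eq_sym neqji mul1r.
Qed.

Lemma wedgevN (v w : 'rV[R]_n) :
  wedge (vec v) (vec w) = - wedge (vec w) (vec v).
Proof.
rewrite /wedge !twisted_mul_vec exchange_big -sumrN.
apply: eq_bigr => i _ /=; rewrite -sumrN; apply: eq_bigr => j _.
have -> : symdiff [set j] [set i] = symdiff [set i] [set j] :> {set 'I_n}.
  by apply/setP => k; rewrite !in_symdiff addbC.
rewrite -scalerN -scaleNr !wedge_sign1 [v 0 j * _]mulrC; congr (_ *: (_ *: _)).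
rewrite -[i == j]/(val i == val j) -[j == i]/(val j == val i) eq_sym.
by case: ltngtP => _; rewrite ?mul0r ?oppr0 ?mul1r ?opprK.
Qed.

Definition inner M N : R := \sum_S M S * N S.

Definition wedge_rows p (v : 'M[R]_(p, n)) : mvec :=
  \big[wedge/1]_(i < p) vec (row i v).

End Multivectors.

Arguments mvec : clear implicits.

From mathcomp Require Import all_classical all_reals all_analysis.

Import numFieldNormedType.Exports.

Section AngleBivector.
Context {R : realType} {n : nat}.
Implicit Types M A B : mvec R n.

Definition mnorm M : R := Num.sqrt (inner M M).

(* The sum of the series is taken coordinatewise, which is the limit for the
   norm since the exterior algebra is finite dimensional. *)
Definition mexp M : mvec R n :=
  [ffun S => limn (fun N => (\sum_(k < N) k`!%:R^-1 *: M ^+ k) S)].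

Definition orthonormal_rows p (e : 'M[R]_(p, n)) : Prop :=
  forall i j, dotv (row i e) (row j e) = (i == j)%:R.

(* [V] and [W] stand for their row spaces, [theta] lists the principal angles
   and the rows of [e] and [f] are associated principal bases. *)
Definition principal_bases p (V W e f : 'M[R]_(p, n)) (theta : 'I_p -> R) :
    Prop :=
  [/\ (e :=: V)%MS /\ (f :=: W)%MS,
      orthonormal_rows e /\ orthonormal_rows f,
      forall i, 0 <= theta i <= pi / 2,
      forall i j : 'I_p, (i <= j)%N -> theta i <= theta j
    & forall i j, dotv (row i e) (row j f) = (i == j)%:R * cos (theta i)].

(* Indices start from 0, hence [i < \rank (e :&: f)] says that the
   1-based index is at most the dimension of the intersection. *)
Definition principal_bivector p (e f : 'M[R]_(p, n)) (i : 'I_p) : mvec R n :=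
  let ef := wedge (vec (row i e)) (vec (row i f)) in
  if (i < \rank (e :&: f)%MS)%N then 0 else (mnorm ef)^-1 *: ef.

Definition angle_bivector p (e f : 'M[R]_(p, n)) (theta : 'I_p -> R) :
    mvec R n :=
  \sum_i theta i *: principal_bivector e f i.

(* The sign epsilon_A with A = epsilon_A ||A|| e_1 ... e_p, for e an
   orthonormal basis of [A]. *)
Definition orientation p A (e : 'M[R]_(p, n)) : R :=
  if A == mnorm A *: \prod_(i < p) vec (row i e) then 1 else -1.

Definition relative_orientation p A B (e f : 'M[R]_(p, n)) : R :=
  orientation A e * orientation B f.

Definition oriented_angle_bivector p A B (e f : 'M[R]_(p.+1, n))
    (theta : 'I_p.+1 -> R) : mvec R n :=
  if relative_orientation A B e f == 1 then angle_bivector e f theta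
  else angle_bivector e f theta - pi *: principal_bivector e f ord_max.

End AngleBivector.

(* Main.v *)
Require Import Defs.
From mathcomp Require Import all_boot all_order all_algebra.
From mathcomp Require Import all_classical all_reals all_analysis.
From mathcomp Require Import ring lra.
Import Order.TTheory GRing.Theory Num.Theory.
Import numFieldNormedType.Exports.
Local Open Scope ring_scope.

Set Implicit Arguments.
Unset Strict Implicit.
Unset Printing Implicit Defensive.

(* Each principal bivector with [theta i != 0] squares to -1 and
   [cos theta_i + sin theta_i I_i = e_i f_i], so [mexp (theta_i I_i) = e_i f_i]
   also when [theta i = 0], where [e_i = f_i].  The [e_i f_i] commute with one
   another and with the [e_j], [j != i], hence
     (e_1 ... e_p) mexp Phi = e_1 (e_1 f_1) ... e_p (e_p f_p) = f_1 ... f_p,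
   and subtracting [pi I_p] from Phi changes the sign.  As [e_1 ... e_p]
   anticommutes with each [I_i], [A mexp Phi = mexp (- Phi) A], and the
   symmetric form follows by halving Phi.  When the relative orientation is -1,
   [theta_p = 0] would give [B = - A]. *)

(** * Products of commuting and anticommuting factors *)

Lemma prodr_mul_commN (A : nzRingType) (I : eqType) (s : seq I) (F G : I -> A) :
  {in s &, forall i j, i != j -> GRing.comm (F i) (G j)} -> uniq s ->
  \prod_(i <- s) F i * \prod_(i <- s) G i = \prod_(i <- s) (F i * G i).
Proof.
elim: s => [|i s IHs] cFG; first by rewrite !big_nil mulr1.
move=> /= /andP[i_s us]; rewrite !big_cons -IHs //; last first.
  by move=> j k js ks; apply: cFG; rewrite inE ?js ?ks orbT.
rewrite -!mulrA; congr (_ * _); rewrite !mulrA; congr (_ * _).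
(* [G i] has to cross only the tail [F j], whose indices differ from [i] by uniqueness of [s]. *)
rewrite big_seq; apply/commr_sym/commr_prod => j js; apply/commr_sym.
apply: cFG; rewrite ?inE ?eqxx ?js ?orbT //.
by apply: contraNneq i_s => <-.
Qed.

(** Carrying [x] across the product changes the sign exactly once, at the single occurrence of
    [i]. *)
Lemma prodr_anticomm1 (A : nzRingType) (I : eqType) (s : seq I) (F : I -> A)
    i x :
  {in s, forall j, j != i -> GRing.comm (F j) x} -> F i * x = - (x * F i) ->
  uniq s -> i \in s -> \prod_(j <- s) F j * x = - (x * \prod_(j <- s) F j).
Proof.
move=> cFx aFx; elim: s cFx => //= j s IHs cFx /andP[j_s us].
have cFx' : {in s, forall k, k != i -> GRing.comm (F k) x}.
  by move=> k ks; apply: cFx; rewrite inE ks orbT.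
rewrite inE big_cons; case: (eqVneq i j) => [Eij _|/= neq_ij is_].
  subst j.
  have cx : GRing.comm x (\prod_(k <- s) F k).
    rewrite big_seq; apply: commr_prod => k ks; apply/commr_sym/cFx' => //.
    by apply: contraNneq j_s => Ek; rewrite -Ek.
  by rewrite -mulrA -cx !mulrA aFx mulNr.
rewrite -mulrA IHs // mulrN !mulrA cFx ?inE ?eqxx // eq_sym.
exact: neq_ij.
Qed.

(** With $x = ab - c$ one has $ab = c + x$ and $ba = c - x$, so $1 = (ab)(ba) = c^2 - x^2$. For unit
    vectors with dot product $c$, $x$ is their wedge product. *)
Lemma unit_bivector_sqr (K : comNzRingType) (A : algType K) (a b : A) c :
  a * a = 1 -> b * b = 1 -> b * a = (2 * c)%:A - a * b ->
  (a * b - c%:A) * (a * b - c%:A) = (c ^+ 2 - 1)%:A.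
Proof.
move=> aa bb ba.
have [x xE] : exists x, x = a * b - c%:A by exists (a * b - c%:A).
have ab : a * b = c%:A + x by rewrite xE addrC subrK.
rewrite -xE; have : a * b * (b * a) = 1 by rewrite mulrA -(mulrA a) bb mulr1.
rewrite ba ab mulr_natl mulr2n [(c + c)%:A]scalerDl opprD addrA addrK.
rewrite mulrBr !mulrDl.
rewrite !mulr_algl !mulr_algr scalerA -expr2 opprD addrA addrK => E1.
by rewrite scalerBl scale1r -[X in _ - X]E1 opprB addrC subrK.
Qed.

(** * The Clifford algebra *)

Section Clifford.
Context {R : numFieldType} {n : nat}.
Implicit Types (M N : mvec R n) (v w : 'rV[R]_n) (S T U : {set 'I_n}).

Lemma geomME M N U :
  (M * N) U = \sum_S reorder_sign S (symdiff S U) * (M S * N (symdiff S U)).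
Proof. exact: twisted_mulE. Qed.

Lemma mvec_sumE (I : Type) (r : seq I) (P : pred I) (F : I -> mvec R n) S :
  (\sum_(i <- r | P i) F i) S = \sum_(i <- r | P i) F i S.
Proof.
apply: (big_morph (fun M : mvec R n => M S) (fun M N => mvecDE M N S)).
by rewrite ffunE.
Qed.

Lemma mvec_basis M : M = \sum_S M S *: basis_blade S.
Proof.
apply/ffunP => T; rewrite mvec_sumE (bigD1 T) //= mvecZE ffunE eqxx mulr1.
rewrite big1 ?addr0 // => S neqST; rewrite mvecZE ffunE eq_sym (negPf neqST).
by rewrite mulr0.
Qed.

Lemma wedgeDl M N P : wedge (M + N) P = wedge M P + wedge N P :> mvec R n.
Proof. exact: twisted_mulDl. Qed.

Lemma wedgeDr M N P : wedge M (N + P) = wedge M N + wedge M P :> mvec R n.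
Proof. exact: twisted_mulDr. Qed.

Lemma wedgeZl a M N : wedge (a *: M) N = a *: wedge M N.
Proof. by rewrite /wedge -twisted_mulZl. Qed.

Lemma wedgeZr a M N : wedge M (a *: N) = a *: wedge M N.
Proof. by rewrite /wedge -twisted_mulZr. Qed.

Lemma wedge0m M : wedge 0 M = 0.
Proof. by rewrite -(scale0r (0 : mvec R n)) wedgeZl !scale0r. Qed.

Lemma wedgem0 M : wedge M 0 = 0.
Proof. by rewrite -(scale0r (0 : mvec R n)) wedgeZr !scale0r. Qed.

Lemma wedge_suml (I : Type) (r : seq I) (P : pred I) (F : I -> mvec R n) N :
  wedge (\sum_(i <- r | P i) F i) N = \sum_(i <- r | P i) wedge (F i) N.
Proof.
exact: (big_morph (fun M => wedge M N) (fun M M' => wedgeDl M M' N)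
  (wedge0m N)).
Qed.

Lemma wedge_sumr (I : Type) (r : seq I) (P : pred I) (F : I -> mvec R n) M :
  wedge M (\sum_(i <- r | P i) F i) = \sum_(i <- r | P i) wedge M (F i).
Proof. exact: (big_morph (wedge M) (wedgeDr M) (wedgem0 M)). Qed.

Lemma dotvC v w : dotv v w = dotv w v.
Proof. by apply: eq_bigr => i _; rewrite mulrC. Qed.

Lemma vec_anticomm v w : vec v * vec w + vec w * vec v = (2 * dotv v w)%:A.
Proof.
rewrite !vecM (dotvC w v) (wedgevN w v) addrACA subrr addr0 -scalerDl.
by rewrite mulrDl mul1r.
Qed.

Lemma vec_sqr v : vec v * vec v = (dotv v v)%:A.
Proof.
have := vec_anticomm v v; rewrite -mulr2n -scaler_nat -scalerA.
by apply: scalerI; rewrite pnatr_eq0.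
Qed.

Lemma vec_ortho v w : dotv v w = 0 -> vec v * vec w = - (vec w * vec v).
Proof.
move=> vw0; apply/eqP; rewrite -addr_eq0 vec_anticomm vw0 mulr0.
by rewrite scale0r.
Qed.

Lemma vec_mulmx p q (P : 'M[R]_(q, p)) (e : 'M[R]_(p, n)) i :
  vec (row i (P *m e)) = \sum_j P i j *: vec (row j e).
Proof.
under [RHS]eq_bigr do rewrite scaler_sumr.
rewrite exchange_big; apply: eq_bigr => k _ /=.
rewrite !mxE scaler_suml; apply: eq_bigr => j _.
by rewrite !mxE scalerA.
Qed.


Lemma symdiffC S T : symdiff S T = symdiff T S.
Proof. by apply/setP => i; rewrite !in_symdiff addbC. Qed.

Lemma basis_bladeM S T :
  basis_blade S * basis_blade T =
  reorder_sign S T *: basis_blade (symdiff S T) :> mvec R n.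
Proof. exact: twisted_mul_basis. Qed.

(** The rule for exchanging $e_i$ and $e_S$: each $j \in S$ other than $i$ is an inversion in
    exactly one of the two orders, and $j = i$ in neither. *)
Lemma reorder_sign1C (i : 'I_n) S :
  (-1) ^+ #|S| * reorder_sign S [set i] =
  (-1) ^+ (i \in S) * reorder_sign [set i] S :> R.
Proof.
have E1 : reorder_sign [set i] S = \prod_(j in S) (-1) ^+ (j < i)%N :> R.
  by rewrite reorder_signE big_set1.
have sqr1 (b : bool) : (-1) ^+ b * (-1) ^+ b = 1 :> R.
  by rewrite -signr_addb addbb.
have E1sqr : reorder_sign [set i] S * reorder_sign [set i] S = 1 :> R.
  by rewrite E1 -big_split big1 //= => j _; rewrite sqr1.
(* Multiplying by a sign that squares to 1 gathers everything into one product over [S]. *)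
suff E : (-1) ^+ #|S| * reorder_sign S [set i] * reorder_sign [set i] S =
         (-1) ^+ (i \in S) :> R.
  by rewrite -E -mulrA E1sqr mulr1.
have -> : reorder_sign S [set i] = \prod_(j in S) (-1) ^+ (i < j)%N :> R.
  by rewrite reorder_signE; apply: eq_bigr => j _; rewrite big_set1.
rewrite E1 -prodr_const -!big_split /=.
transitivity (\prod_(j in S) (-1) ^+ (j == i) : R).
  apply: eq_bigr => j _; rewrite -(inj_eq val_inj) /=.
  by case: ltngtP; rewrite ?mulr1 ?mul1r ?mulrNN ?mulr1.
rewrite big_mkcond (bigD1 i) //= eqxx big1 ?mulr1 => [|j /negPf ->].
  by case: (i \in S).
by case: ifP.
Qed.

(** The main involution of the Clifford algebra, the automorphism extending $v \mapsto -v$. It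
    carries the signs that arise when a vector moves across a multivector. *)
Definition grade_inv M : mvec R n :=
  [ffun S : {set 'I_n} => (-1) ^+ #|S| * M S].

Lemma grade_invE M :
  grade_inv M = \sum_(S : {set 'I_n}) M S *: ((-1) ^+ #|S| *: basis_blade S).
Proof.
rewrite [LHS]mvec_basis; apply: eq_bigr => S _.
by rewrite ffunE scalerA mulrC.
Qed.

(* For basis blades [e_i] and [e_S], both sides vanish if [i \in S], and
   otherwise [e_i] and [e_S] commute up to [(-1) ^+ #|S|]. *)
Lemma wedge_vecE v M :
  wedge (vec v) M = 2^-1 *: (vec v * M + grade_inv M * vec v).
Proof.
rewrite grade_invE [in LHS](mvec_basis M) [in X in X + _](mvec_basis M).
rewrite wedge_sumr mulr_sumr mulr_suml -big_split scaler_sumr /=.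
apply: eq_bigr => S _.
rewrite wedgeZr -scalerAr -scalerAl -scalerDr scalerA mulrC -scalerA.
congr (_ *: _).
rewrite wedge_suml mulr_suml mulr_sumr -big_split scaler_sumr /=.
apply: eq_bigr => i _.
rewrite wedgeZl -scalerAl -scalerAr -scalerDr scalerA mulrC -scalerA.
congr (_ *: _).
rewrite -scalerAl !basis_bladeM /wedge twisted_mul_basis (symdiffC S) scalerA.
rewrite reorder_sign1C -scalerDl scalerA /wedge_sign disjoints1.
rewrite -{2}[reorder_sign [set i] S]mul1r -mulrDl mulrA; congr (_ * _ *: _).
case: (i \in S) => /=; first by rewrite expr1 subrr mulr0.
by rewrite expr0 -(natrD _ 1 1) mulVf // pnatr_eq0.
Qed.

(** The parity of the cardinality is additive under symmetric difference. *)
Lemma grade_invM M N : grade_inv (M * N) = grade_inv M * grade_inv N.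
Proof.
apply/ffunP => U; rewrite ffunE !geomME mulr_sumr; apply: eq_bigr => S _.
rewrite !ffunE mulrCA; congr (_ * _); rewrite mulrACA; congr (_ * _).
have sgn (V : {set 'I_n}) : (-1) ^+ #|V| = \prod_(i in V) -1 :> R.
  by rewrite prodr_const.
rewrite !sgn -prod_symdiff ?symdiffKs // => i.
by rewrite mulrNN mulr1.
Qed.

Lemma grade_inv1 : grade_inv 1 = 1.
Proof.
apply/ffunP => S; rewrite !ffunE; case: eqP => [->|_]; last by rewrite mulr0.
by rewrite cards0 mulr1.
Qed.

Lemma grade_inv_vec v : grade_inv (vec v) = - vec v.
Proof.
apply/ffunP => S; rewrite [RHS]ffunE ffunE mvec_sumE -sumrN mulr_sumr.
apply: eq_bigr => i _; rewrite mvecZE ffunE.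
case: eqP => [->|_]; last by rewrite !mulr0 oppr0.
by rewrite cards1 expr1 mulN1r.
Qed.

Lemma wedgevv v : wedge (vec v) (vec v) = 0.
Proof. by apply: (addrI (dotv v v)%:A); rewrite -vecM vec_sqr addr0. Qed.

(** * Wedge products of families of vectors *)

Section Products.
Context (I : eqType) (e : I -> 'rV[R]_n).

(** In [wedge_vecE] the two terms coincide: each factor contributes one sign through [grade_inv] and
    one by anticommuting with [v]. *)
Lemma wedge_prod_ortho (s : seq I) v :
  {in s, forall j, dotv v (e j) = 0} ->
  wedge (vec v) (\prod_(j <- s) vec (e j)) = vec v * \prod_(j <- s) vec (e j).
Proof.
move=> vs; rewrite wedge_vecE.
suff -> : grade_inv (\prod_(j <- s) vec (e j)) * vec v =
          vec v * \prod_(j <- s) vec (e j).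
  rewrite -mulr2n -[X in _ *: X]scaler_nat scalerA mulVf ?pnatr_eq0 //.
  by rewrite scale1r.
elim: s vs => [|j s IHs] vs.
  by rewrite big_nil grade_inv1 mulr1 mul1r.
rewrite big_cons grade_invM -mulrA IHs ?mulrA => [|k ks]; last first.
  by apply: vs; rewrite inE ks orbT.
rewrite grade_inv_vec mulNr; congr (_ * _).
by rewrite [RHS]vec_ortho ?opprK // vs // inE eqxx.
Qed.

Lemma wedge_ortho (s : seq I) :
  {in s &, forall i j, i != j -> dotv (e i) (e j) = 0} -> uniq s ->
  \big[wedge/1]_(j <- s) vec (e j) = \prod_(j <- s) vec (e j).
Proof.
elim: s => [|i s IHs] es; first by rewrite !big_nil.
move=> /= /andP[is_ us]; rewrite !big_cons IHs //; last first.
  by move=> j k js ks; apply: es; rewrite inE ?js ?ks orbT.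
apply: wedge_prod_ortho => j js; apply: es; rewrite ?inE ?eqxx ?js ?orbT //.
by apply: contraNneq is_ => ->.
Qed.

Local Notation W s := (\big[wedge/1]_(j <- s) vec (e j)).


(** The vector is carried rightwards, up to sign, until it meets its own copy. *)
Lemma wedge_mem0 (s : seq I) j : j \in s -> wedge (vec (e j)) (W s) = 0.
Proof.
elim: s => // k s IHs; rewrite inE big_cons wedgeA.
case: eqVneq => [<- _|_ /= /IHs js]; first by rewrite wedgevv wedge0m.
by rewrite wedgevN -scaleN1r wedgeZl -wedgeA js wedgem0 scaler0.
Qed.

Lemma wedge_not_uniq (s : seq I) : ~~ uniq s -> W s = 0.
Proof.
elim: s => //= j s IHs; rewrite big_cons negb_and negbK.
by case/orP => [/wedge_mem0//|/IHs ->]; rewrite wedgem0.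
Qed.

(** The head of [s] is located in [t] and brought to the front, one sign per vector crossed; the
    tails are handled by induction. *)
Lemma wedge_perm (s t : seq I) :
  perm_eq s t -> exists b : bool, W s = (-1) ^+ b *: W t.
Proof.
elim: s t => [|j s IHs] t pst.
  move: pst; rewrite perm_sym => /perm_nilP ->.
  by exists false; rewrite scale1r.
have /splitPr jt : j \in t by rewrite -(perm_mem pst) mem_head.
case: jt pst => t1 t2; rewrite perm_sym perm_catC cat_cons perm_cons.
rewrite perm_catC perm_sym => /IHs[b Ws].
have [c Wt] : exists c : bool,
    W (t1 ++ j :: t2) = (-1) ^+ c *: wedge (vec (e j)) (W (t1 ++ t2)).
  elim: t1 {Ws} => [|k t1 [c Wt]].
    by exists false; rewrite big_cons scale1r.
  exists (~~ c); rewrite /= !big_cons Wt wedgeZr !wedgeA wedgevN.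
  by rewrite -[- wedge _ _]scaleN1r wedgeZl scalerA signrN mulrN1.
exists (b (+) c); rewrite Wt big_cons Ws wedgeZr scalerA signr_addb -mulrA.
by rewrite -signr_addb addbb mulr1.
Qed.
End Products.

(** Multilinear expansion of the wedge product, phrased as an induction principle so that no sum
    over index sequences has to be written. *)
Lemma wedge_lincomb_ind p q (e : 'M[R]_(p, n)) (P : 'M[R]_(q, p)) (s : seq 'I_q)
    (Q : mvec R n -> Prop) :
  Q 0 -> (forall a M N, Q M -> Q N -> Q (a *: M + N)) ->
  (forall t : seq 'I_p, size t = size s ->
     Q (\big[wedge/1]_(j <- t) vec (row j e))) ->
  Q (\big[wedge/1]_(i <- s) vec (row i (P *m e))).
Proof.
elim: s Q => [|i s IHs] Q Q0 QD QW.
  by have := QW [::] erefl; rewrite !big_nil.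
(* The tail is expanded first, with the unexpanded first vector absorbed into the property. *)
rewrite big_cons; apply: (IHs (fun M => Q (wedge _ M))) => [|a M N QM QN|t ts].
- by rewrite wedgem0.
- by rewrite wedgeDr wedgeZr; apply: QD.
rewrite vec_mulmx wedge_suml; elim/big_rec: _ => [//|j M _ QM].
rewrite wedgeZl; apply: QD => //; have := QW (j :: t).
by rewrite big_cons; apply; rewrite /= ts.
Qed.

(** In the expansion, sequences with a repetition vanish and the others are permutations of all the
    rows. The scalar can be taken to be $\det P$, but a norm comparison will fix it up to sign, so
    existence suffices. *)
Lemma wedge_rows_mulmx p (P : 'M[R]_p) (e : 'M[R]_(p, n)) :
  exists c, wedge_rows (P *m e) = c *: wedge_rows e.
Proof.
apply: (@wedge_lincomb_ind _ _ e P (index_enum 'I_p)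
          (fun M => exists c, M = c *: wedge_rows e)) => [||t ts].
- by exists 0; rewrite scale0r.
- by move=> a _ _ [b ->] [c ->]; exists (a * b + c); rewrite scalerDl scalerA.
have [ut|nut] := boolP (uniq t); last first.
  by exists 0; rewrite wedge_not_uniq // scale0r.
have /wedge_perm-/(_ (fun j => row j e))[b ->] : perm_eq t (index_enum 'I_p).
  apply: uniq_perm => //; first exact: index_enum_uniq.
  have sub : {subset t <= index_enum 'I_p} by move=> j _; apply: mem_index_enum.
  by case: (uniq_min_size ut sub) => //; rewrite ts.
by exists ((-1) ^+ b).
Qed.

(** * The inner product and multiplication by vectors *)

Lemma inner_vecMl v M N : inner (vec v * M) N = inner M (vec v * N).
Proof.
rewrite /inner.
have coef M' S : (vec v * M') S = \sum_i v 0 i *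
    (reorder_sign [set i] (symdiff [set i] S) * M' (symdiff [set i] S)).
  rewrite mulr_suml mvec_sumE; apply: eq_bigr => i _.
  by rewrite -scalerAl mvecZE [X in _ * X]twisted_mul_basisl.
under eq_bigr do rewrite coef mulr_suml.
under [RHS]eq_bigr do rewrite coef mulr_sumr.
rewrite exchange_big [RHS]exchange_big; apply: eq_bigr => i _ /=.
(* Left multiplication by $e_i$ swaps $e_S$ and $e_T$, $T$ being the symmetric difference of $\{i\}$
   and $S$, with the same sign both ways since $e_i^2 = 1$. Hence it is self-adjoint. *)
rewrite [RHS](reindex_inj (inv_inj (symdiffKs [set i]))) /=.
apply: eq_bigr => S _; rewrite symdiffKs reorder_signDr.
rewrite reorder_sign1 ltnn mul1r.
by rewrite [RHS]mulrCA -mulrA; congr (_ * _); rewrite -mulrA [RHS]mulrCA.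
Qed.

Lemma innerC M N : inner M N = inner N M.
Proof. by apply: eq_bigr => S _; rewrite mulrC. Qed.

Lemma innerDl M N M' : inner (M + N) M' = inner M M' + inner N M'.
Proof.
by rewrite /inner -big_split; apply: eq_bigr => S _; rewrite ffunE mulrDl.
Qed.

Lemma innerZl a M N : inner (a *: M) N = a * inner M N.
Proof.
by rewrite /inner mulr_sumr; apply: eq_bigr => S _; rewrite mvecZE mulrA.
Qed.

Lemma innerDr M N M' : inner M' (M + N) = inner M' M + inner M' N.
Proof. by rewrite innerC innerDl !(innerC M'). Qed.

Lemma innerZr a M N : inner M (a *: N) = a * inner M N.
Proof. by rewrite innerC innerZl innerC. Qed.

Lemma inner_vecM v M N :
  inner (vec v * M) (vec v * N) = dotv v v * inner M N.
Proof.
by rewrite inner_vecMl mulrA vec_sqr -scalerAl mul1r innerZr.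
Qed.

Lemma inner11 : inner 1 (1 : mvec R n) = 1.
Proof.
rewrite /inner (bigD1 finset.set0) //= !ffunE eqxx mulr1 big1 ?addr0 // => S S0.
by rewrite ffunE (negPf S0) mulr0.
Qed.

Lemma inner_vec v w : inner (vec v) (vec w) = dotv v w.
Proof.
have E v' w' : inner (vec v') (vec w') = inner (vec w' * vec v') 1.
  by rewrite inner_vecMl mulr1.
have : inner (vec v) (vec w) + inner (vec w) (vec v) = 2 * dotv v w.
  by rewrite !E -innerDl addrC vec_anticomm innerZl inner11 mulr1.
rewrite (innerC (vec w)) -mulr2n => E2; apply: (@mulfI R 2).
  by rewrite pnatr_eq0.
by rewrite -E2 mulr_natl.
Qed.

Lemma inner_prod_vec (I : Type) (s : seq I) (e : I -> 'rV[R]_n) :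
  (forall i, dotv (e i) (e i) = 1) ->
  inner (\prod_(i <- s) vec (e i)) (\prod_(i <- s) vec (e i)) = 1.
Proof.
move=> e1; elim: s => [|i s IHs]; first by rewrite big_nil inner11.
by rewrite big_cons inner_vecM e1 IHs mul1r.
Qed.

(** The Gram determinant, which for unit vectors at angle $\theta$ is $\sin^2\theta$. *)
Lemma inner_wedge_vec v w :
  inner (wedge (vec v) (vec w)) (wedge (vec v) (vec w)) =
  dotv v v * dotv w w - dotv v w ^+ 2.
Proof.
have -> : wedge (vec v) (vec w) = vec v * vec w + (- dotv v w) *: 1.
  by rewrite vecM scaleNr addrC addKr.
have E1 : inner (vec v * vec w) 1 = dotv v w.
  by rewrite inner_vecMl mulr1 inner_vec dotvC.
rewrite !(innerDl, innerDr, innerZl, innerZr) inner_vecM inner_vec inner11.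
rewrite (innerC 1) E1; ring.
Qed.

End Clifford.

(** * The exponential *)

Section ExpPartialSums.
Context {K : numFieldType} {A : algType K}.
Implicit Types x y : A.

(** Taken in an arbitrary algebra, to serve both for multivectors and for the real numbers that
    bound them. *)
Definition exp_psum x N : A := \sum_(k < N) k`!%:R^-1 *: x ^+ k.

(** By the binomial theorem, the partial sum at $x + y$ collects the terms with $i + j < N$ of the
    $N \times N$ square formed by the product. *)
Lemma exp_psumD x y N : GRing.comm x y ->
  exp_psum x N * exp_psum y N - exp_psum (x + y) N =
  \sum_(i < N) \sum_(j < N | (N <= i + j)%N)
     (i`!%:R^-1 * j`!%:R^-1) *: (x ^+ i * y ^+ j).
Proof.
move=> cxy; pose g i j : A := (i`!%:R^-1 * j`!%:R^-1) *: (x ^+ i * y ^+ j).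
have -> : exp_psum x N * exp_psum y N = \sum_(i < N) \sum_(j < N) g i j.
  rewrite mulr_suml; apply: eq_bigr => i _; rewrite mulr_sumr.
  by apply: eq_bigr => j _; rewrite -scalerAr -scalerAl scalerA mulrC.
have -> : exp_psum (x + y) N =
    \sum_(i < N) \sum_(j < N | ~~ (N <= i + j)%N) g i j.
  (* The terms are grouped by $k = i + j$. *)
  transitivity (\sum_(k < N) \sum_(j < N) \sum_(i < N | (i + j == k)%N) g i j).
    apply: eq_bigr => k _; rewrite exprDn_comm // scaler_sumr.
    rewrite (big_ord_widen N (fun j => k`!%:R^-1 *:
      (x ^+ (k - j) * y ^+ j *+ 'C(k, j)))) // big_mkcond.
    apply: eq_bigr => j _ /=; rewrite ltnS; case: leqP => [jk|kj]; last first.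
      by rewrite big_pred0 // => i; rewrite gtn_eqF // ltn_addl.
    have kjN : (k - j < N)%N by rewrite (leq_ltn_trans (leq_subr _ _)).
    rewrite (big_pred1 (Ordinal kjN)) => [|i] /=; last first.
      by rewrite -val_eqE /= -(eqn_add2r j i) subnK.
    rewrite /g -[_ *+ 'C(_, _)]scaler_nat scalerA -(bin_fact jk) !natrM.
    congr (_ *: _).
    have f0 m : m`!%:R != 0 :> K by rewrite pnatr_eq0 -lt0n fact_gt0.
    have b0 : 'C(k, j)%:R != 0 :> K by rewrite pnatr_eq0 -lt0n bin_gt0.
    by rewrite !invfM mulrAC mulVf // mul1r mulrC.
  rewrite exchange_big /= [RHS](exchange_big_dep xpredT) //=.
  apply: eq_bigr => j _; rewrite (exchange_big_dep xpredT) //=.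
  rewrite [RHS]big_mkcond; apply: eq_bigr => i _; rewrite -ltnNge.
  case: ifP => [ijN|ijN].
    by rewrite (big_pred1 (Ordinal ijN)).
  by rewrite big_pred0 // => k; apply: contraFF ijN => /eqP ->.
rewrite -sumrB; apply: eq_bigr => i _.
by rewrite (bigID (fun j : 'I_N => (N <= i + j)%N)) /= addrK.
Qed.

End ExpPartialSums.

Section MultivectorExponential.
Local Open Scope classical_set_scope.
Context {R : realType} {n : nat}.
Implicit Types (M N : mvec R n) (S : {set 'I_n}).

(** A submultiplicative norm, because the structure constants are signs. [mnorm] is not one: $1 +
    e_1$ has norm $\sqrt 2$ and its square $2(1 + e_1)$ has norm $2\sqrt 2$. *)
Definition l1norm M : R := \sum_S `|M S|.

Lemma l1norm_ge0 M : 0 <= l1norm M.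
Proof. exact: sumr_ge0. Qed.

Lemma le_l1norm M S : `|M S| <= l1norm M.
Proof. by rewrite /l1norm (bigD1 S) //= lerDl sumr_ge0. Qed.

Lemma l1normZ a M : l1norm (a *: M) = `|a| * l1norm M.
Proof. by rewrite mulr_sumr; apply: eq_bigr => S _; rewrite mvecZE normrM. Qed.

Lemma l1norm_sum (I : Type) (r : seq I) (P : pred I) (F : I -> mvec R n) :
  l1norm (\sum_(i <- r | P i) F i) <= \sum_(i <- r | P i) l1norm (F i).
Proof.
rewrite /l1norm exchange_big; apply: ler_sum => S _.
by rewrite mvec_sumE ler_norm_sum.
Qed.

Lemma norm_reorder_sign S T : `|reorder_sign S T : R| = 1.
Proof.
rewrite reorder_signE normr_prod big1 // => i _.
by rewrite normr_prod big1 // => j _; rewrite normrX normrN1 expr1n.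
Qed.

Lemma l1normM M N : l1norm (M * N) <= l1norm M * l1norm N.
Proof.
rewrite /l1norm mulr_suml.
apply: (@le_trans _ _ (\sum_U \sum_S `|M S| * `|N (symdiff S U)|)).
  apply: ler_sum => U _; rewrite geomME; apply: le_trans (ler_norm_sum _ _ _) _.
  by apply: ler_sum => S _; rewrite !normrM norm_reorder_sign mul1r.
rewrite exchange_big; apply: ler_sum => S _.
rewrite -mulr_sumr ler_wpM2l //.
by rewrite [in leRHS](reindex_inj (inv_inj (symdiffKs S))).
Qed.

Lemma l1norm1 : l1norm 1 = 1.
Proof.
rewrite /l1norm (bigD1 finset.set0) //= ffunE eqxx normr1 big1 ?addr0 //.
move=> S S0.
by rewrite ffunE (negPf S0) normr0.
Qed.

Lemma l1normX M k : l1norm (M ^+ k) <= l1norm M ^+ k.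
Proof.
elim: k => [|k IHk]; first by rewrite !expr0 l1norm1.
rewrite !exprS; apply: le_trans (l1normM _ _) _.
by rewrite ler_wpM2l ?l1norm_ge0.
Qed.

Definition mcvg (u : nat -> mvec R n) M : Prop :=
  forall S, (fun k => u k S : R) @ \oo --> (M S : R).

Lemma mcvg_unique u M N : mcvg u M -> mcvg u N -> M = N.
Proof.
by move=> uM uN; apply/ffunP => S; exact: (cvg_unique _ (uM S) (uN S)).
Qed.

Lemma mcvg_cst M : mcvg (fun=> M) M.
Proof. by move=> S; apply: cvg_cst. Qed.

Lemma mcvgD u v M N : mcvg u M -> mcvg v N -> mcvg (fun k => u k + v k) (M + N).
Proof.
move=> uM vN S; rewrite ffunE; under eq_fun do rewrite ffunE.
exact: cvgD (uM S) (vN S).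
Qed.

Lemma mcvgM u v M N : mcvg u M -> mcvg v N -> mcvg (fun k => u k * v k) (M * N).
Proof.
move=> uM vN U; rewrite geomME; under eq_fun do rewrite geomME.
apply: cvg_big => [|S _]; first exact: add_continuous.
apply: cvgM; first exact: cvg_cst.
exact: cvgM (uM S) (vN _).
Qed.

Lemma exp_psumE (x : R) :
  exp_psum (x : R^o) = series (exp_coeff x) :> (nat -> R).
Proof.
apply/funext => m; rewrite /series /= big_mkord; apply: eq_bigr => k _.
by rewrite /exp_coeff /= mulrC.
Qed.

(** Each coordinate is dominated by the real exponential series at [l1norm M]. *)
Lemma mexp_cvg M : mcvg (exp_psum M) (mexp M).
Proof.
move=> S; rewrite ffunE.
have -> : (fun k => exp_psum M k S) =
          series (fun k => k`!%:R^-1 * (M ^+ k) S) :> (nat -> R).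
  apply/funext => m; rewrite /series /= big_mkord mvec_sumE.
  by apply: eq_bigr => k _; rewrite mvecZE.
apply: normed_cvg.
apply: series_le_cvg (is_cvg_series_exp_coeff (l1norm M)) => [k|k|k].
- exact: normr_ge0.
- by rewrite divr_ge0 // exprn_ge0 // l1norm_ge0.
rewrite /exp_coeff /= normrM ger0_norm ?invr_ge0 // mulrC.
rewrite ler_wpM2r ?invr_ge0 //.
exact: le_trans (le_l1norm _ _) (l1normX _ _).
Qed.

Lemma mexp_eq M N : mcvg (exp_psum M) N -> mexp M = N.
Proof. exact: (mcvg_unique (@mexp_cvg M)). Qed.

(* The defect of multiplicativity of the partial sums at [M] and [N] is
   dominated by the one at the real numbers [l1norm M] and [l1norm N]. *)
Lemma mexpD M N : GRing.comm M N -> mexp (M + N) = mexp M * mexp N.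
Proof.
move=> cMN; apply/eqP; rewrite eq_sym -subr_eq0; apply/eqP.
pose a := l1norm M; pose b := l1norm N.
have cvgl : mcvg (fun k => exp_psum M k * exp_psum N k - exp_psum (M + N) k)
                 (mexp M * mexp N - mexp (M + N)).
  apply: mcvgD; first by apply: mcvgM; apply: mexp_cvg.
  move=> S; rewrite ffunE; under eq_fun do rewrite ffunE.
  exact: cvgN (@mexp_cvg _ S).
apply: (mcvg_unique cvgl) => S; rewrite ffunE.
(* The real defect tends to 0 by the functional equation of [expR]; it serves as the upper bound in
   the squeeze. *)
have cvgr : (fun k => (exp_psum (a : R^o) k * exp_psum (b : R^o) k
              - exp_psum (a + b : R^o) k : R)) @ \oo --> (0 : R).
  rewrite !exp_psumE -(subrr (expR (a + b))) [in X in X - _]expRD.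
  apply: cvgB; last exact: is_cvg_series_exp_coeff.
  by apply: cvgM; apply: is_cvg_series_exp_coeff.
apply: norm_cvg0; apply: (squeeze_cvgr _ (cvg_cst 0) cvgr).
apply: nearW => k; rewrite normr_ge0 /= exp_psumD // exp_psumD; last first.
  exact: mulrC.
apply: le_trans (le_l1norm _ _) _; apply: le_trans (l1norm_sum _ _ _) _.
apply: ler_sum => i _; apply: le_trans (l1norm_sum _ _ _) _.
apply: ler_sum => j _; rewrite l1normZ ger0_norm ?mulr_ge0 ?invr_ge0 //.
rewrite ler_wpM2l ?mulr_ge0 ?invr_ge0 //; apply: le_trans (l1normM _ _) _.
by apply: ler_pM; rewrite ?l1norm_ge0 // l1normX.
Qed.

Lemma mexp0 : mexp 0 = 1 :> mvec R n.
Proof.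
(* The partial sums equal 1 only from index 1 on, the empty one being 0. *)
apply: mexp_eq => S; apply: cvg_near_cst; exists 1%N => // -[//|k] _ /=.
rewrite /exp_psum big_ord_recl expr0 fact0 invr1 scale1r big1 ?addr0 // => i _.
by rewrite expr0n scaler0.
Qed.

Lemma mexp_sum (I : eqType) (r : seq I) (F : I -> mvec R n) :
  {in r &, forall i j, GRing.comm (F i) (F j)} ->
  mexp (\sum_(i <- r) F i) = \prod_(i <- r) mexp (F i).
Proof.
elim: r => [|i r IHr] cF; first by rewrite !big_nil mexp0.
rewrite !big_cons mexpD ?IHr // => [j k jr kr|].
  by apply: cF; rewrite inE ?jr ?kr orbT.
rewrite big_seq; apply: commr_sum => j jr.
by apply: cF; rewrite inE ?eqxx ?jr ?orbT.
Qed.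

(** Termwise $N M^k = (-M)^k N$, and multiplication passes to the limit. *)
Lemma mexp_anticomm M N : N * M = - (M * N) -> N * mexp M = mexp (- M) * N.
Proof.
move=> NM; apply: (mcvg_unique (mcvgM (@mcvg_cst N) (@mexp_cvg M))).
have -> : (fun k => N * exp_psum M k) = (fun k => exp_psum (- M) k * N).
  apply/funext => k; rewrite mulr_sumr mulr_suml; apply: eq_bigr => i _.
  rewrite -scalerAr -scalerAl; congr (_ *: _).
  elim: (nat_of_ord i) => [|m IHm]; first by rewrite !expr0 mulr1 mul1r.
  by rewrite exprSr mulrA IHm -mulrA NM -mulNr mulrA -exprSr.
exact: mcvgM (@mexp_cvg _) (@mcvg_cst N).
Qed.

(** Euler's formula: even powers of [M] are real and give the cosine series, odd powers are
    multiples of [M] and give the sine series. *)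
Lemma mexp_sqrN1 M t : M * M = -1 -> mexp (t *: M) = (cos t)%:A + sin t *: M.
Proof.
move=> MM; apply: mexp_eq.
have -> : exp_psum (t *: M) = fun k =>
    (series (cos_coeff t) k)%:A + series (sin_coeff t) k *: M.
  apply/funext => k; rewrite /series /= !big_mkord !scaler_suml -big_split.
  apply: eq_bigr => i _; rewrite exprZn scalerA mulrC /=.
  have MX m : M ^+ m = ((~~ odd m)%:R * (-1) ^+ m./2)%:A
                       + ((odd m)%:R * (-1) ^+ m.-1./2) *: M.
    rewrite -[in LHS](odd_double_half m) -muln2 mulnC exprD exprM expr2 MM.
    rewrite -scaleN1r exprZn expr1n; case: (boolP (odd m)) => odd_m /=.
      rewrite !mul0r scale0r add0r !mul1r expr1 -scalerAr mulr1.
      congr (_ ^+ _ *: _).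
      by case: m odd_m => // m /= /negPf; rewrite uphalf_half => ->.
    by rewrite !mul0r scale0r addr0 !mul1r.
  rewrite MX scalerDr !scalerA /cos_coeff /sin_coeff /=.
  by congr (_ *: _ + _ *: _); rewrite mulrC mulrA.
move=> S; rewrite !ffunE.
under eq_fun do rewrite !ffunE.
apply: cvgD; apply: cvgM; rewrite ?unlock; try exact: cvg_cst.
exact: is_cvg_series_cos_coeff.
exact: is_cvg_series_sin_coeff.
Qed.

End MultivectorExponential.

(** * Principal bivectors *)

Section Blades.
Context {R : realType} {n : nat}.
Implicit Types (M N A B : mvec R n).

Lemma mnormZ a M : mnorm (a *: M) = `|a| * mnorm M.
Proof.
rewrite /mnorm innerZl innerZr mulrA -expr2 sqrtrM ?sqr_ge0 //.
by rewrite sqrtr_sqr.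
Qed.

(** Since [orientation] defaults to -1, the point is that no third coefficient can occur: [A] is a
    multiple $c\,e_1 \cdots e_p$, and comparing norms gives $|c| = 1$. *)
Lemma blade_orientation p (v e : 'M[R]_(p, n)) A :
  A = wedge_rows v -> mnorm A = 1 -> (e :=: v)%MS -> orthonormal_rows e ->
  A = orientation A e *: \prod_(i < p) vec (row i e).
Proof.
move=> Av A1 ev ortho_e; rewrite /orientation A1 scale1r.
case: eqP => [->|]; first by rewrite scale1r.
have /submxP[P vP] : (v <= e)%MS by rewrite ev.
have [c Ac] := wedge_rows_mulmx P e.
move: A1; rewrite {}Av {}vP {}Ac /wedge_rows.
rewrite wedge_ortho ?index_enum_uniq // => [|i j _ _ /negPf ij]; last first.
  by rewrite ortho_e ij.
rewrite mnormZ /mnorm inner_prod_vec => [|i]; last by rewrite ortho_e eqxx.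
rewrite sqrtr1 mulr1 => /eqP; rewrite eqr_norml ler01 andbT.
by case/orP => /eqP -> //; rewrite scale1r.
Qed.

End Blades.

Section PrincipalBivectors.
Context {R : realType} {n p : nat}.
Context (e f : 'M[R]_(p, n)) (theta : 'I_p -> R).
Context (ortho_e : orthonormal_rows e) (ortho_f : orthonormal_rows f).
Context (theta_itv : forall i, 0 <= theta i <= pi / 2).
Context (theta_homo : forall i j : 'I_p, (i <= j)%N -> theta i <= theta j).
Context (dot_ef :
  forall i j, dotv (row i e) (row j f) = (i == j)%:R * cos (theta i)).

Lemma principal_sin_gt0 i : theta i != 0 -> 0 < sin (theta i).
Proof.
move=> t0; have /andP[t_ge0 t_le] := theta_itv i; apply: sin_gt0_pi.
have := pi_gt0 R.
have : 0 < theta i by rewrite lt_neqAle eq_sym t0.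
lra.
Qed.

(** $\|e_i - f_i\|^2 = 1 + 1 - 2\cos 0 = 0$. *)
Lemma principal_row_eq i : theta i = 0 -> row i e = row i f.
Proof.
move=> t0; apply/eqP; rewrite -subr_eq0; set x := row i e - row i f.
have x0 : \sum_k x 0 k ^+ 2 = 0.
  transitivity (dotv (row i e) (row i e) + dotv (row i f) (row i f)
                - 2 * dotv (row i e) (row i f)).
    rewrite /dotv mulr_sumr -sumrN -!big_split; apply: eq_bigr => k _ /=.
    rewrite !mxE; ring.
  by rewrite ortho_e ortho_f dot_ef eqxx t0 cos0; ring.
apply/eqP/rowP => k; rewrite [RHS]mxE; apply/eqP; rewrite -sqrf_eq0; apply/eqP.
by apply: (psumr_eq0P _ x0) => // j _; apply: sqr_ge0.
Qed.

Lemma dotvE (q r : nat) (a : 'M[R]_(q, n)) (b : 'M[R]_(r, n)) i j :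
  dotv (row i a) (row j b) = (a *m b^T) i j.
Proof. by rewrite mxE; apply: eq_bigr => k _; rewrite !mxE. Qed.

(* If [a *m e = b *m f], taking inner products with the [e_j] and the [f_j]
   gives [a_j = b_j cos theta_j] and [b_j = a_j cos theta_j]. *)
Lemma rank_cap_principal i : theta i != 0 -> (\rank (e :&: f)%MS <= i)%N.
Proof.
move=> ti; have /submxP[a Xa] := capmxSl e f; have /submxP[b Xb] := capmxSr e f.
have ee : e *m e^T = 1%:M by apply/matrixP => k l; rewrite -dotvE ortho_e mxE.
have ff : f *m f^T = 1%:M by apply/matrixP => k l; rewrite -dotvE ortho_f mxE.
pose c := \row_k cos (theta k).
have ef : e *m f^T = diag_mx c.
  apply/matrixP => k l; rewrite -dotvE dot_ef !mxE.
  by case: eqP => [->|_]; rewrite ?mul1r ?mul0r.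
have fe : f *m e^T = diag_mx c.
  by rewrite -[LHS]trmxK trmx_mul trmxK ef tr_diag_mx.
have ab : a = b *m diag_mx c.
  by rewrite -fe mulmxA -Xb Xa -mulmxA ee mulmx1.
have ba : b = a *m diag_mx c.
  by rewrite -ef mulmxA -Xa Xb -mulmxA ff mulmx1.
(* For $l \ge i$ also $\theta_l > 0$ by monotonicity, and $a_l = a_l \cos^2\theta_l$ forces $a_l =
   0$. *)
have a0 k (l : 'I_p) : (i <= l)%N -> a k l = 0.
  move=> il; have tl : theta l != 0.
    rewrite gt_eqF //; apply: lt_le_trans (theta_homo il).
    by rewrite lt_neqAle eq_sym ti; case/andP: (theta_itv i).
  have : a k l * sin (theta l) ^+ 2 = 0.
    have Ea : a k l = a k l * cos (theta l) ^+ 2.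
      by rewrite {1}ab {1}ba !mul_mx_diag !mxE expr2 mulrA.
    by rewrite sin2cos2 mulrBr mulr1 -Ea subrr.
  by move/eqP; rewrite mulf_eq0 expf_eq0 /= (gt_eqF (principal_sin_gt0 tl))
    orbF => /eqP.
(* Only the first [i] columns of [a] survive, so the intersection factors through a matrix of rank
   [i]. *)
have -> : (e :&: f)%MS = a *m (pid_mx i *m e).
  rewrite Xa mulmxA; congr (_ *m _); apply/matrixP => k l.
  rewrite mxE (bigD1 l) //= !mxE eqxx /= big1 ?addr0 => [|m neq_ml].
    by case: ltnP => il; rewrite ?mulr1 // mulr0 a0.
  by rewrite mxE (inj_eq val_inj) (negPf neq_ml) mulr0.
apply: leq_trans (mxrankM_maxr _ _) _; apply: leq_trans (mxrankM_maxl _ _) _.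
by rewrite rank_pid_mx // ltnW.
Qed.

Local Notation E i := (vec (row i e)).
Local Notation F i := (vec (row i f)).
Local Notation PB i := (principal_bivector e f i).

Lemma principal_vec_sqr i : E i * E i = 1.
Proof. by rewrite vec_sqr ortho_e eqxx scale1r. Qed.

(** Covers the zero and the normalized case at once, which is enough for every commutation rule. *)
Lemma principal_bivectorE i :
  exists k, PB i = k *: (E i * F i - (cos (theta i))%:A).
Proof.
have -> : E i * F i - (cos (theta i))%:A = wedge (E i) (F i).
  by rewrite vecM dot_ef eqxx mul1r addrAC subrr add0r.
rewrite /principal_bivector; case: ifP => _; first by exists 0; rewrite scale0r.
by exists (mnorm (wedge (E i) (F i)))^-1.
Qed.

(** A nonzero angle places [i] beyond the intersection, and there the Gram determinant gives the
    norm $\sin\theta_i$. *)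
Lemma principal_bivector_sin i : theta i != 0 ->
  PB i = (sin (theta i))^-1 *: (E i * F i - (cos (theta i))%:A).
Proof.
move=> ti; rewrite /principal_bivector ltnNge rank_cap_principal //=.
rewrite /mnorm inner_wedge_vec ortho_e ortho_f dot_ef !eqxx !mul1r.
rewrite -sin2cos2 sqrtr_sqr.
rewrite ger0_norm ?ltW ?principal_sin_gt0 //; congr (_ *: _).
by rewrite vecM dot_ef eqxx mul1r addrAC subrr add0r.
Qed.


Lemma principal_mul_rev i :
  F i * E i = (2 * cos (theta i))%:A - E i * F i.
Proof.
have := vec_anticomm (row i e) (row i f); rewrite dot_ef eqxx mul1r => <-.
by rewrite addrAC subrr add0r.
Qed.

Lemma principal_bivector_sqr i : theta i != 0 -> PB i * PB i = -1.
Proof.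
move=> ti; rewrite principal_bivector_sin // -scalerAl -scalerAr scalerA.
rewrite (unit_bivector_sqr _ _ (principal_mul_rev i)) ?principal_vec_sqr //.
  2: by rewrite vec_sqr ortho_f eqxx scale1r.
rewrite -[_ - 1]opprB -sin2cos2 scaleNr.
rewrite scalerN scalerA -expr2 exprVn mulVf ?scale1r //.
by rewrite expf_neq0 // gt_eqF ?principal_sin_gt0.
Qed.

Lemma mexp_principal i : mexp (theta i *: PB i) = E i * F i.
Proof.
have [t0|ti] := eqVneq (theta i) 0.
  by rewrite t0 scale0r mexp0 -principal_row_eq // principal_vec_sqr.
rewrite mexp_sqrN1 ?principal_bivector_sqr // principal_bivector_sin //.
rewrite scalerA divff ?scale1r ?gt_eqF ?principal_sin_gt0 //.
by rewrite addrC subrK.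
Qed.

(** $e_i$ is orthogonal to both $e_j$ and $f_j$, so two signs cancel. *)
Lemma principal_vec_comm i j : i != j -> GRing.comm (E i) (E j * F j).
Proof.
move=> ij; rewrite /GRing.comm mulrA vec_ortho ?ortho_e ?(negPf ij) //.
rewrite -mulNr -!mulrA vec_ortho ?dot_ef ?(negPf ij) ?mul0r //.
by rewrite mulrNN.
Qed.

Lemma principal_vecr_comm i j : i != j -> GRing.comm (F i) (E j * F j).
Proof.
move=> ij; rewrite /GRing.comm mulrA [F i * E j]vec_ortho; last first.
  by rewrite dotvC dot_ef eq_sym (negPf ij) mul0r.
rewrite mulNr -!mulrA [F i * F j]vec_ortho ?mulrN ?opprK //.
by rewrite ortho_f (negPf ij).
Qed.

Lemma comm_principal_bivector i x :
  GRing.comm x (E i * F i) -> GRing.comm x (PB i).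
Proof.
move=> cx; have [k ->] := principal_bivectorE i.
rewrite /GRing.comm -scalerAr -scalerAl mulrBr mulrBl cx.
by rewrite mulr_algl mulr_algr.
Qed.

Lemma principal_bivector_comm i j : GRing.comm (PB i) (PB j).
Proof.
have [->|ij] := eqVneq i j; first by [].
apply/comm_principal_bivector/commr_sym/comm_principal_bivector/commr_sym.
apply/commr_sym/commrM; apply/commr_sym; first exact: principal_vec_comm.
exact: principal_vecr_comm.
Qed.

Local Notation ME := (\prod_(i < p) E i).

(** Only the factor $e_i$ matters, and with $c = \cos\theta_i$, $e_i(e_i f_i - c) = f_i - c\,e_i =
    -(e_i f_i - c)e_i$. *)
Lemma principal_blade_anticomm i : ME * PB i = - (PB i * ME).
Proof.
apply: (@prodr_anticomm1 _ _ _ _ i);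
  rewrite ?index_enum_uniq ?mem_index_enum //.
  by move=> j _ ji; apply: comm_principal_bivector; apply: principal_vec_comm.
have [k ->] := principal_bivectorE i.
rewrite -scalerAr -scalerAl -[- (k *: _)]scalerN; congr (_ *: _).
rewrite mulrBr mulrBl mulrA principal_vec_sqr mul1r -mulrA principal_mul_rev.
rewrite mulrBr [E i * (E i * F i)]mulrA principal_vec_sqr mul1r.
rewrite !mulr_algl !mulr_algr mulr_natl mulr2n scalerDl.
rewrite opprB opprB opprD addrCA.
by congr (_ + _); rewrite addrA subrr add0r.
Qed.

Lemma angle_bivector_anticomm :
  ME * angle_bivector e f theta = - (angle_bivector e f theta * ME).
Proof.
rewrite mulr_sumr mulr_suml -sumrN; apply: eq_bigr => i _.
by rewrite -scalerAr -scalerAl principal_blade_anticomm scalerN.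
Qed.

Lemma mul_mexp_angle_bivector :
  ME * mexp (angle_bivector e f theta) = \prod_(i < p) F i.
Proof.
rewrite mexp_sum => [|i j _ _]; last first.
  rewrite /GRing.comm -!scalerAl -!scalerAr principal_bivector_comm.
  by rewrite scalerA mulrC -scalerA.
under [X in _ * X]eq_bigr do rewrite mexp_principal.
(* Interleaving the two products puts each $e_i$ next to its own $e_i f_i$. *)
rewrite prodr_mul_commN ?index_enum_uniq // => [|i j _ _]; last first.
  exact: principal_vec_comm.
by apply: eq_bigr => i _; rewrite mulrA principal_vec_sqr mul1r.
Qed.

Lemma angle_bivector_comm i : GRing.comm (angle_bivector e f theta) (PB i).
Proof.
apply/commr_sym/commr_sum => j _; apply/commr_sym.
by rewrite /GRing.comm -scalerAl -scalerAr principal_bivector_comm.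
Qed.

End PrincipalBivectors.

Theorem proposition3p9 (R : realType) (n p : nat) (A B : mvec R n)
  (v w e f : 'M[R]_(p.+1, n)) (theta : 'I_p.+1 -> R)
  (A_blade : A = wedge_rows v) (B_blade : B = wedge_rows w)
  (normA : mnorm A = 1) (normB : mnorm B = 1)
  (ef_principal : principal_bases v w e f theta)
  (B_neq_oppA : B <> - A) :
  let Phi := oriented_angle_bivector A B e f theta in
  [/\ B = mexp (- (2^-1 *: Phi)) * A * mexp (2^-1 *: Phi),
      B = A * mexp Phi
    & B = mexp (- Phi) * A].
Proof.
case: ef_principal => -[ev fw] [ortho_e ortho_f] t_itv t_homo dot_ef Phi.
have EA := blade_orientation A_blade normA ev ortho_e.
have EB := blade_orientation B_blade normB fw ortho_f.
pose F := \prod_i vec (row i f); pose Phi0 := angle_bivector e f theta.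
pose I := principal_bivector e f.
have AI i : A * I i = - (I i * A).
  rewrite EA -scalerAl -scalerAr.
  by rewrite (principal_blade_anticomm ortho_e dot_ef) scalerN.
have APhi : A * Phi = - (Phi * A).
  have APhi0 : A * Phi0 = - (Phi0 * A).
    by rewrite EA -scalerAl -scalerAr angle_bivector_anticomm // scalerN.
  rewrite /Phi /oriented_angle_bivector; case: ifP => // _.
  rewrite mulrBr mulrBl -scalerAr -scalerAl APhi0 AI scalerN.
  by rewrite opprB opprK addrC.
have AexpPhi0 : A * mexp Phi0 = orientation A e *: F.
  by rewrite {1}EA -scalerAl mul_mexp_angle_bivector.
have BE : B = A * mexp Phi.
  rewrite /Phi /oriented_angle_bivector /relative_orientation -/Phi0.
  case: eqP => [AB1|AB1].
    rewrite AexpPhi0 EB; congr (_ *: _); move: AB1; rewrite /orientation.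
    by case: ifP; case: ifP => //; rewrite ?mul1r ?mulr1 // => _ _ /eqP;
       rewrite eqNr oner_eq0.
  have oBA : orientation B f = - orientation A e.
    move: AB1; rewrite /orientation; case: ifP; case: ifP;
    by rewrite ?mulrNN ?mulr1 ?mul1r ?opprK.
  (* If the largest angle were 0, all would be, so $e_i = f_i$ for every $i$ and the opposite
     orientations would give $B = -A$, which is excluded. *)
  have t_max : theta ord_max != 0.
    apply: contra_not_neq B_neq_oppA => t0; rewrite EA EB oBA scaleNr.
    congr (- (_ *: _)); apply: eq_bigr => i _; congr (vec _); apply/esym.
    apply: (principal_row_eq ortho_e ortho_f dot_ef); apply/eqP.
    by rewrite eq_le -{1}t0 t_homo ?leq_ord //; case/andP: (t_itv i).
  rewrite mexpD; last first.
    rewrite /GRing.comm mulrN mulNr -scalerAr -scalerAl.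
    by rewrite (angle_bivector_comm ortho_e ortho_f dot_ef).
  (* As $I_p^2 = -1$, the exponential of $-\pi I_p$ is $\cos\pi - \sin\pi\, I_p = -1$, which
     supplies the missing sign. *)
  have I1 := principal_bivector_sqr ortho_e ortho_f t_itv t_homo dot_ef t_max.
  rewrite mulrA AexpPhi0 -scaleNr (mexp_sqrN1 _ I1).
  rewrite cosN sinN cospi sinpi oppr0 scale0r addr0 mulr_algr.
  by rewrite scaleN1r -scaleNr -oBA.
have antih : A * (2^-1 *: Phi) = - (2^-1 *: Phi * A).
  by rewrite -scalerAr -scalerAl APhi scalerN.
split; [|exact: BE|by rewrite -(mexp_anticomm APhi)].
(* The left half-angle factor moves across [A] with its exponent negated, and the two equal halves
   then combine into [mexp Phi]. *)
rewrite -(mexp_anticomm antih) -mulrA -(mexpD (commr_refl _)) -scalerDl.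
have -> : 2^-1 + 2^-1 = 1 :> R by field.
by rewrite scale1r.
Qed.
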